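(* Assume that $\Gamma:[0,\infty)\to\mathbb{R}$, $\Gamma(s)=\int_s^\infty \mathbb{E}[g(X_t,t)g(X_s,s)]\,dt$, is a non-negative, strictly decreasing, smooth function. Let $m>0$ and consider $$V(m):=\inf_{Q\in\mathcal{M}(\mathbb{R}^+):\ \mathbb{E}^Q[N]=m}\operatorname{Var}\left(\int_0^\infty g(X_s,s)\frac{1_{\{N>s\}}}{Q(N>s)}\,ds\right).$$ (i) If $m>\int_0^\infty\sqrt{\Gamma(u)}\,du/\sqrt{\Gamma(0)}$, then the infimum is attained at the distribution $Q^*$ given by $$Q^*(N>s)=\begin{cases}1 & \text{for } 0\le s\le s^*,\\ \sqrt{\dfrac{\Gamma(s)}{\Gamma(s^* )}} & \text{for } s>s^*,\end{cases}$$ where $s^*$ is the unique positive solution of $$s^*+\frac{\int_{s^*}^\infty\sqrt{\Gamma(u)}\,du}{\sqrt{\Gamma(s^* )}}=m,$$ and the minimum variance is $$V(m)=2\int_0^{s^*}\Gamma(s)\,ds+2\Gamma(s^* )(m-s^* )-\alpha^2.$$ (ii) If $m\le\int_0^\infty\sqrt{\Gamma(u)}\,du/\sqrt{\Gamma(0)}$, then the infimum is attained at the distribution $Q^*$ given by $$Q^*(N>s)=\frac{m\sqrt{\Gamma(s)}}{\int_0^\infty\sqrt{\Gamma(u)}\,du},\qquad s\ge0,$$ and the minimum variance is $$V(m)=\frac{2}{m}\left(\int_0^\infty\sqrt{\Gamma(u)}\,du\right)^2-\alpha^2.$$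
   Context: $X=\{X_t:t\ge0\}$ is a stochastic process on a metric space $\mathcal{X}$, and $g:\mathcal{X}\times\mathbb{R}_+\to\mathbb{R}$ is such that $(t,\omega)\mapsto g(X_t(\omega),t)$ is jointly measurable; $\alpha:=\mathbb{E}\left[\int_0^\infty g(X_s,s)\,ds\right]$. $\mathcal{M}(\mathbb{R}^+)$ denotes the set of probability distributions $Q$ of a random variable $N$, independent of $X$, with $Q(N\ge0)=1$ and $Q(N>s)>0$ for all $s\in[0,\infty)$. $\mathbb{E}^Q[N]=\int_0^\infty Q(N>s)\,ds$ is the mean of $N$ under $Q$. Standing integrability assumption (all expectations and variances considered are finite and well-defined): the integral defining $\Gamma(s)$ converges absolutely for every $s\ge 0$; $$\int_0^\infty\frac{1}{\sqrt{\Gamma(s)}}\int_s^\infty\mathbb{E}\big|g(X_s,s)g(X_t,t)\big|\,dt\,ds<\infty$$ (which implies $\int_0^\infty\sqrt{\Gamma(s)}\,ds<\infty$ and $\mathbb{E}[(\int_0^\infty|g(X_s,s)|ds)^2]<\infty$); and the infimum of the variance is taken over those $Q$ for which $\mathbb{E}\big[\big(\int_0^\infty|g(X_s,s)|\frac{1_{\{N>s\}}}{Q(N>s)}ds\big)^2\big]<\infty$. *)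

(* Defs.v *)
From HB Require Import structures.
From mathcomp Require Import all_boot all_order all_algebra.
From mathcomp Require Import all_classical all_reals all_analysis.

Set Implicit Arguments.
Unset Strict Implicit.
Unset Printing Implicit Defensive.

Import Order.TTheory GRing.Theory Num.Theory.
Import numFieldNormedType.Exports.

Local Open Scope classical_set_scope.
Local Open Scope ring_scope.

(* [X t] is relevant for [t >= 0] only; the state space carries its Borel
   sigma-algebra. *)
Definition stochastic_process d (Omega : measurableType d) (R : realType)
    (E : metricType R) (X : R -> Omega -> E) : Prop :=
  forall t, 0 <= t -> forall B, <<s (@open E) >> B ->
    d.-measurable (X t @^-1` B).

(* Infinite differentiability relative to [D]: the difference quotients are
   taken inside [D], hence one-sidedly at an endpoint of [D].  [F n] is the
   n-th derivative. *)
Definition smooth_on (R : realType) (D : set R) (f : R -> R) : Prop :=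
  exists F : nat -> R -> R,
    (forall s, D s -> F 0%N s = f s) /\
    (forall n s, D s ->
       (F n y - F n s) / (y - s) @[y --> within (D `\ s) (nbhs s)]
         --> F n.+1 s).

Section process.
Context d (Omega : measurableType d) (R : realType) (P : probability Omega R)
  (E : metricType R) (X : R -> Omega -> E) (g : E -> R -> R).

Local Notation mu := (@lebesgue_measure R).

Definition gX (t : R) (w : Omega) : R := g (X t w) t.

Definition jointly_measurable : Prop :=
  @measurable_fun _ _ (measurableTypeR R * Omega)%type R
    (`[0, +oo[%classic `*` setT) (fun z => gX z.1 z.2).

Definition alpha : R :=
  fine 'E_P[fun w => \int[mu]_(s in `[0, +oo[) gX s w].

Definition Gamma (s : R) : R :=
  fine (\int[mu]_(t in `[s, +oo[) 'E_P[fun w => (gX t w * gX s w)%R])%E.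

(* Since the integrand takes values in [\bar R], integrability here entails
   that [gX t * gX s] has a finite expectation for almost every [t >= s]. *)
Definition Gamma_converges : Prop :=
  forall s, 0 <= s ->
    mu.-integrable `[s, +oo[ (fun t => 'E_P[fun w => (gX t w * gX s w)%R])%E.

Definition Gamma_weighted_finite : Prop :=
  (\int[mu]_(s in `[0%R, +oo[)
     (((Num.sqrt (Gamma s))^-1)%:E *
      \int[mu]_(t in `[s, +oo[) 'E_P[fun w => `|gX s w * gX t w|%R])
   < +oo)%E.

Definition int_sqrt_Gamma (s : R) : R :=
  \int[mu]_(u in `[s, +oo[) Num.sqrt (Gamma u).

Definition law_class (Q : probability R R) : Prop :=
  Q `[0, +oo[%classic = 1%E /\ forall s, 0 <= s -> (0 < Q `]s, +oo[%classic)%E.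

Definition tail (Q : probability R R) (s : R) : R := fine (Q `]s, +oo[%classic).

(* A law [Q] of [N] independent of [X] is realised on [Omega * R] with measure
   [P \x Q]: the process depends on the first coordinate only, and [N] is the
   second coordinate. *)
Definition estimator (Q : probability R R) (w : Omega * R) : R :=
  \int[mu]_(s in `[0, +oo[) (gX s w.1 * (\1_(`]s, +oo[%classic) w.2 / tail Q s)).

Definition estimator_variance (Q : probability R R) : \bar R :=
  'V_(P \x Q)[estimator Q]%E.

Definition estimator_abs_L2 (Q : probability R R) : Prop :=
  (\int[P \x Q]_w
     (\int[mu]_(s in `[0%R, +oo[)
        (`|gX s w.1| * (\1_(`]s, +oo[%classic) w.2 / tail Q s))%R%:E) ^+ 2
   < +oo)%E.

Definition feasible (m : R) (Q : probability R R) : Prop :=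
  [/\ law_class Q, ('E_Q[fun n => n] = m%:E)%E & estimator_abs_L2 Q].

Definition min_variance (m : R) : \bar R :=
  ereal_inf [set estimator_variance Q | Q in feasible m].

Definition attained_at (m : R) (Q : probability R R) : Prop :=
  feasible m Q /\ estimator_variance Q = min_variance m.

End process.

(* Main.v *)
(* Writing q s = Q(N > s), Fubini and the independence of N give
   Var = 2 * int_0^oo G(s) / q(s) ds - alpha^2 for every admissible law, so one
   minimises int G / q under the constraint int q = E[N] = m.  For each level
   lam > 0 the tail q* = min(1, sqrt(G / lam)) minimises G / q + lam * q
   pointwise over 0 < q <= 1; integrating this inequality and cancelling the
   common term lam * m shows that q* is optimal as soon as int q* = m.  The
   level is lam = G(sstar) in case (i) and lam = (I(0) / m)^2 >= G(0), for which
   the cap at 1 is inactive, in case (ii). *)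
Require Import Defs.
From HB Require Import structures.
From mathcomp Require Import all_boot all_order all_algebra.
From mathcomp Require Import all_classical all_reals all_analysis.
From mathcomp Require Import measurable_realfun ring lra.

Set Implicit Arguments.
Unset Strict Implicit.

Import Order.TTheory GRing.Theory Num.Theory.
Import numFieldNormedType.Exports.

Local Open Scope classical_set_scope.
Local Open Scope ring_scope.

(** * Integrals over products *)

(** Only [1 / q s] survives in the second moment because, in the squared time integral, the weights
    at times [s <= t] multiply to the indicator of [N > t] over [q s * q t], and averaging over [N]
    cancels [q t]. Folding the symmetric kernel onto [s <= t] gives the factor 2, and the inner
    integral over [t] is then [Gamma s]. The obstacle is the legitimacy of these exchanges. The same
    computation is first made with absolute values, where Tonelli needs no finiteness. For a
    competing law, whose absolute second moment is finite by feasibility, this yields the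
    integrability that Fubini requires. For the candidate it is read the other way: its inverse tail
    is at most a constant times [1 / sqrt Gamma], so [Gamma_weighted_finite] proves that the
    candidate is feasible. The multiplier [lam] is fixed by the mean. Capping at level [G s] gives
    mean [s + I s / sqrt (G s)], which increases strictly from [I 0 / sqrt (G 0)] at [s = 0]; this
    value is the threshold between the two cases. *)

Section product_square.
Context d (T : measurableType d) (R : realType).
Context (mu : {sigma_finite_measure set T -> \bar R}).
Local Open Scope ereal_scope.

(* [mu \x mu] is canonically sigma-finite in the library for subprobabilities
   only. *)
Definition prod_sqr : set (T * T) -> \bar R := mu \x mu.

HB.instance Definition _ := Measure.on prod_sqr.

(** Squares of an increasing exhaustion [F] suffice: a pair with coordinates in [F m] and [F n] lies
    in the square of index [maxn m n]. *)
Let prod_sqr_sigma_finite : sigma_finite setT prod_sqr.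
Proof.
have /sigma_finiteP[F [TF ndF Foo]] := sigma_finiteT mu.
exists (fun n => F n `*` F n) => [|n].
  apply/esym; rewrite -subTset => -[x y] _.
  have [[m _ Fx] [n _ Fy]] : (\bigcup_n F n) x /\ (\bigcup_n F n) y by rewrite -TF.
  exists (maxn m n) => //; split => /=.
    by move/subsetPset : (ndF _ _ (leq_maxl m n)); apply.
  by move/subsetPset : (ndF _ _ (leq_maxr m n)); apply.
have [mFn Fnoo] := Foo n; split; first exact: measurableX.
by rewrite /prod_sqr product_measure1E// lte_mul_pinfty// ge0_fin_numE.
Qed.

HB.instance Definition _ :=
  Measure_isSigmaFinite.Build _ _ _ prod_sqr prod_sqr_sigma_finite.

End product_square.

Lemma ge0_integral_prodM d1 d2 (T1 : measurableType d1) (T2 : measurableType d2)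
    (R : realType) (m1 : {sigma_finite_measure set T1 -> \bar R})
    (m2 : {sigma_finite_measure set T2 -> \bar R})
    (phi : T1 -> \bar R) (psi : T2 -> \bar R) :
  measurable_fun setT phi -> measurable_fun setT psi ->
  (forall x, 0 <= phi x)%E -> (forall y, 0 <= psi y)%E ->
  (\int[m1 \x m2]_z (phi z.1 * psi z.2) =
   \int[m1]_x phi x * \int[m2]_y psi y)%E.
Proof.
move=> mphi mpsi phi0 psi0; rewrite fubini_tonelli1/=; last 2 first.
- by apply: emeasurable_funM; exact: measurableT_comp.
- by move=> z; exact: mule_ge0.
rewrite -ge0_integralZr ?integral_ge0//.
by apply: eq_integral => x _; rewrite -ge0_integralZl.
Qed.

(** [a] may be non-integrable, which later allows kernels whose expectation is not known to be
    finite at each pair of times. Since [b >= 0], multiplying by [b] commutes with taking positive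
    and negative parts, and Tonelli applies to each part. *)
Lemma integral_prodM d1 d2 (T1 : measurableType d1) (T2 : measurableType d2)
    (R : realType) (m1 : {sigma_finite_measure set T1 -> \bar R})
    (m2 : {sigma_finite_measure set T2 -> \bar R}) (a : T1 -> R) (b : T2 -> R) :
  measurable_fun setT a -> measurable_fun setT b -> (forall y, 0 <= b y)%R ->
  (\int[m2]_y (b y)%:E \is a fin_num)%E ->
  (\int[m1 \x m2]_z (a z.1 * b z.2)%:E =
   \int[m1]_x (a x)%:E * \int[m2]_y (b y)%:E)%E.
Proof.
move=> ma mb b0 bfin.
have mb' : measurable_fun setT (fun y => (b y)%:E) by exact/measurable_EFinP.
have ma' : measurable_fun setT (fun x => (a x)%:E) by exact/measurable_EFinP.
have pos (c : T1 -> \bar R) : measurable_fun setT c -> (forall x, 0 <= c x)%E ->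
    (\int[m1 \x m2]_z (c z.1 * (b z.2)%:E) =
     \int[m1]_x c x * \int[m2]_y (b y)%:E)%E.
  by move=> mc c0; rewrite (@ge0_integral_prodM _ _ _ _ _ m1 m2 c (EFin \o b)).
have maxM (x y : R) : 0 <= y -> Num.max (x * y) 0 = Num.max x 0 * y.
  by move=> y0; rewrite maxr_pMl// mul0r.
rewrite integralE (_ : _^\+ = fun z => ((EFin \o a)^\+ z.1 * (b z.2)%:E))%E; last first.
  by apply/funext => z; rewrite !funeposE/= -EFin_max maxM// EFinM EFin_max.
rewrite (_ : _^\- = fun z => ((EFin \o a)^\- z.1 * (b z.2)%:E))%E; last first.
  apply/funext => z; rewrite !funenegE/= -mulNr -EFin_max maxM//.
  by rewrite EFinM EFin_max.
rewrite !pos//; [|exact: measurable_funeneg|exact: measurable_funepos].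
rewrite [in RHS]integralE -(fineK bfin).
have : 0 <= fine (\int[m2]_y (b y)%:E)%E.
  by rewrite fine_ge0// integral_ge0// => y _; rewrite lee_fin.
have : (0 <= \int[m1]_x (EFin \o a)^\+ x)%E by exact: integral_ge0.
have : (0 <= \int[m1]_x (EFin \o a)^\- x)%E by exact: integral_ge0.
move: (fine (\int[m2]_y (b y)%:E)%E) => B.
(* Both sides vanish when [B = 0]. When [B > 0], multiplication by [B] preserves infinite values,
   including the conventional value of [+oo - +oo]. *)
case: (\int[m1]_x (EFin \o a)^\- x)%E => [q||]// q0;
  case: (\int[m1]_x (EFin \o a)^\+ x)%E => [p||]// p0;
  rewrite le_eqVlt => /predU1P[<-|B0];
  rewrite ?mule0 ?sube0 ?gt0_mulye ?gt0_mulNye ?lte_fin//=.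
by rewrite -EFinM -!EFinD -EFinM mulrBl.
Qed.

(** * Second moments of integrals over a parameter: Tonelli, then Fubini *)

Section second_moment.
Context d1 d2 (T1 : measurableType d1) (T2 : measurableType d2) (R : realType).
Context (mu : {sigma_finite_measure set T1 -> \bar R}) (P : probability T2 R).
Local Open Scope ereal_scope.

Lemma integral_sqr (phi : T1 -> R) : mu.-integrable setT (EFin \o phi) ->
  (prod_sqr mu).-integrable setT (fun z => (phi z.1 * phi z.2)%:E) /\
  ((\int[mu]_s phi s) ^+ 2)%:E = \int[prod_sqr mu]_z (phi z.1 * phi z.2)%:E.
Proof.
move=> iphi; have /integrableP[mphi phifin] := iphi.
have mprod : measurable_fun setT (fun z : T1 * T1 => (phi z.1 * phi z.2)%:E).
  move/measurable_EFinP : mphi => mphi.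
  by apply/measurable_EFinP/measurable_funM; exact: measurableT_comp.
have iprod : (prod_sqr mu).-integrable setT (fun z => (phi z.1 * phi z.2)%:E).
  apply/integrableP; split=> //.
  under eq_integral => z _ do rewrite EFinM abseM.
  rewrite (@ge0_integral_prodM _ _ _ _ _ mu mu (fun s => `|(phi s)%:E|) (fun s => `|(phi s)%:E|))//;
    [|exact: measurableT_comp..].
  by rewrite lte_mul_pinfty// ?integral_ge0// ge0_fin_numE// integral_ge0.
split=> //; rewrite -integral12_prod_meas1//.
have fphi := integrable_fin_num measurableT iphi.
under eq_integral => s _.
  rewrite /fubini_F/=.
  under eq_integral => t _ do rewrite EFinM.
  rewrite integralZl//; over.
have -> : \int[mu]_t (phi t)%:E = (\int[mu]_s phi s)%:E.
  by rewrite /Rintegral fineK.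
by rewrite integralZr// -[X in _ = X * _]fineK// -EFinM expr2.
Qed.

Variable f : T1 * T2 -> R.
Hypothesis mf : measurable_fun setT f.

Let h (z : T1 * T1) (w : T2) : R := (f (z.1, w) * f (z.2, w))%R.

Let mh : measurable_fun setT (fun x : (T1 * T1) * T2 => (h x.1 x.2)%:E).
Proof.
apply/measurable_EFinP/measurable_funM; apply: (measurableT_comp mf);
  apply: measurable_fun_pair => //; exact: measurableT_comp.
Qed.

Let mf1 w : measurable_fun setT (fun s => (f (s, w))%:E).
Proof. by apply/measurable_EFinP; exact: measurable_fun_pair1. Qed.

Lemma integral_sqr_abs :
  \int[P]_w (\int[mu]_s `|(f (s, w))%:E|) ^+ 2 =
  \int[prod_sqr mu]_z \int[P]_w `|(f (z.1, w) * f (z.2, w))%:E|.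
Proof.
transitivity (\int[P]_w \int[prod_sqr mu]_z `|(h z w)%:E|).
  apply: eq_integral => w _; rewrite expe2.
  have mfw : measurable_fun setT (fun s => `|(f (s, w))%:E|).
    by apply: measurableT_comp => //; exact: mf1.
  rewrite -(@ge0_integral_prodM _ _ _ _ _ mu mu _ _ mfw mfw)//.
  by under eq_integral => z _ do rewrite -abseM -EFinM.
apply/esym/(fubini_tonelli (fun x : (T1 * T1) * T2 => `|(h x.1 x.2)%:E|)) => //.
exact: measurableT_comp.
Qed.

(** Under a probability the second moment controls the first through [x <= 1 + x ^ 2]. *)
Lemma integrable_sqr_abs_lty :
  \int[P]_w (\int[mu]_s `|(f (s, w))%:E|) ^+ 2 < +oo ->
  (mu \x P).-integrable setT (EFin \o f).
Proof.
move=> hfin; have mf' : measurable_fun setT (EFin \o f) by exact/measurable_EFinP.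
apply/integrable21ltyP => //.
have mI : measurable_fun setT (fun w => \int[mu]_s `|(f (s, w))%:E|).
  apply: (measurable_fun_fubini_tonelli_G (fun x => `|(f x)%:E|)) => //.
  exact: measurableT_comp.
have I0 w : 0 <= \int[mu]_s `|(f (s, w))%:E| by exact: integral_ge0.
have mI2 : measurable_fun setT (fun w => (\int[mu]_s `|(f (s, w))%:E|) ^+ 2).
  exact: emeasurable_funM.
have I2 w : 0 <= (\int[mu]_s `|(f (s, w))%:E|) ^+ 2 by exact: sqre_ge0.
apply: (@le_lt_trans _ _ (\int[P]_w (1 + (\int[mu]_s `|(f (s, w))%:E|) ^+ 2))).
  apply: ge0_le_integral => //.
  - by move=> w _; exact: I0.
  - exact: emeasurable_funD.
  - move=> w _; move: (I0 w); rewrite expe2; case: (\int[mu]_s _) => [r r0|_|//].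
      by rewrite -EFinM -EFinD lee_fin; nra.
    by rewrite mulyy addey.
rewrite ge0_integralD//.
by rewrite integral_cst//= lte_add_pinfty// probability_setT mule1 ltry.
Qed.

(** By [integral_sqr_abs] the hypothesis says exactly that the product kernel [h] is absolutely
    integrable on the triple product, so Fubini applies to its signed version. *)
Lemma integral_sqr_signed :
  \int[P]_w (\int[mu]_s `|(f (s, w))%:E|) ^+ 2 < +oo ->
  [/\ (prod_sqr mu).-integrable setT
        (fun z => \int[P]_w (f (z.1, w) * f (z.2, w))%:E),
      P.-integrable setT (fun w => ((\int[mu]_s f (s, w)) ^+ 2)%:E) &
  \int[P]_w ((\int[mu]_s f (s, w)) ^+ 2)%:E =
  \int[prod_sqr mu]_z \int[P]_w (f (z.1, w) * f (z.2, w))%:E].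
Proof.
move=> /[dup] hfin; have intf := integrable_sqr_abs_lty hfin.
rewrite integral_sqr_abs => {}hfin.
have inth : (prod_sqr mu \x P).-integrable setT
    (fun x : (T1 * T1) * T2 => (h x.1 x.2)%:E).
  exact/integrable12ltyP.
(* The real-valued integral is the [fine] part of an extended one, so the square is a double
   integral only where the section of [f] at [w] is integrable, which is almost everywhere. *)
have aeP : ae_eq P setT (fubini_G (prod_sqr mu) (fun x => (h x.1 x.2)%:E))
    (fun w => ((\int[mu]_s f (s, w)) ^+ 2)%:E).
  have := ae_integrable2 intf; apply: filterS => w /= iw _.
  by rewrite (integral_sqr iw).2.
have mR : measurable_fun setT (fun w => ((\int[mu]_s f (s, w)) ^+ 2)%:E).
  apply/measurable_EFinP/measurable_funX.
  exact: (measurableT_comp (fine_measurable measurableT) (measurable_fubini_G intf)).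
have mG := measurable_fubini_G inth.
split.
- exact: (integrable_fubini_F inth).
- apply/integrableP; split=> //.
  have : \int[P]_w `|fubini_G (prod_sqr mu) (fun x => (h x.1 x.2)%:E) w| < +oo.
    rewrite (le_lt_trans _ ((integrable21ltyP _ _ mh).1 inth))//.
    apply: ge0_le_integral => //; first exact: measurableT_comp.
      apply: (measurable_fun_fubini_tonelli_G (fun x : (T1 * T1) * T2 => `|(h x.1 x.2)%:E|)) => //.
      exact: measurableT_comp.
    move=> w _; apply: le_abse_integral => //.
    exact: (measurable_fun_pair1 w mh).
  rewrite (ae_eq_integral (fun w => `|((\int[mu]_s f (s, w)) ^+ 2)%:E|))//.
  + exact: measurableT_comp.
  + exact: measurableT_comp.
  + by apply: filterS aeP => w /= + _ => ->.
- by rewrite -(ae_eq_integral _ _ _ _ _ aeP)// (Fubini inth).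
Qed.

Lemma Rintegral_mean : (mu \x P).-integrable setT (EFin \o f) ->
  measurable_fun setT (fun w => \int[mu]_s f (s, w))%R /\
  \int[P]_w (\int[mu]_s f (s, w))%:E = \int[mu]_s \int[P]_w (f (s, w))%:E.
Proof.
move=> intf.
have mR : measurable_fun setT (fun w => \int[mu]_s f (s, w))%R.
  exact: (measurableT_comp (fine_measurable measurableT) (measurable_fubini_G intf)).
split=> //; rewrite (Fubini intf).
apply: ae_eq_integral => //; first exact/measurable_EFinP.
  exact: (measurable_fubini_G intf).
have := ae_integrable2 intf; apply: filterS => w /= iw _.
by rewrite fineK//; exact: integrable_fin_num iw.
Qed.

Lemma integrable_Rintegral :
  \int[P]_w (\int[mu]_s `|(f (s, w))%:E|) ^+ 2 < +oo ->
  P.-integrable setT (fun w => (\int[mu]_s f (s, w))%:E).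
Proof.
move=> hfin; have [_ intsqr _] := integral_sqr_signed hfin.
have i1 : P.-integrable setT (EFin \o cst 1%R) by exact: finite_measure_integrable_cst.
apply: (le_integrable _ _ _ (integrableD _ i1 intsqr)) => //.
  by apply/measurable_EFinP; exact: (Rintegral_mean (integrable_sqr_abs_lty hfin)).1.
move=> w _ /=; rewrite lee_fin; set y := (\int[mu]_s f (s, w))%R.
rewrite [leRHS]ger0_norm; last by rewrite addr_ge0// sqr_ge0.
by rewrite ler_norml; apply/andP; split; nra.
Qed.

End second_moment.

Section symmetric_kernel.
Context (R : realType).
Local Notation MR := (measurableTypeR R).
Local Notation mu := (@lebesgue_measure R).
Local Open Scope ereal_scope.

(** The plane is cut along the diagonal. On each half the outer integral runs over the smaller
    coordinate, and symmetry of [K] makes the two halves equal. The disjunction serves the absolute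
    kernel by Tonelli and the signed one by Fubini. *)
Lemma integral_symmetric (K : MR * MR -> \bar R) :
  measurable_fun setT K -> (forall s t, K (s, t) = K (t, s)) ->
  (forall z, 0 <= K z) \/ (prod_sqr mu).-integrable setT K ->
  \int[prod_sqr mu]_z K z = 2%:E * \int[mu]_s \int[mu]_(t in `[s, +oo[) K (s, t).
Proof.
move=> mK symK K0.
pose A : set (MR * MR) := [set z | (z.1 <= z.2)%R].
have mA : measurable A.
  have := measurable_fun_ler (@measurable_fst _ _ MR MR) (@measurable_snd _ _ MR MR).
  by move=> /(_ measurableT [set true]); rewrite setTI; exact.
have cut (D : set (MR * MR)) : measurable D ->
    \int[prod_sqr mu]_(z in D) K z = \int[mu]_s \int[mu]_t (K \_ D) (s, t) /\
    \int[prod_sqr mu]_(z in D) K z = \int[mu]_t \int[mu]_s (K \_ D) (s, t).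
  move=> mD; rewrite integral_mkcond.
  have mKD : measurable_fun setT (K \_ D).
    apply: (measurable_restrictT K mD).1. exact: measurable_funTS.
  case: K0 => [K0|iK].
    have KD0 z : 0 <= (K \_ D) z by apply: erestrict_ge0 => x _.
    by split; [exact: (fubini_tonelli1 (K \_ D))|exact: (fubini_tonelli2 (K \_ D))].
  have iKD : (prod_sqr mu).-integrable setT (K \_ D).
    by apply/integrable_restrict => //; rewrite setTI; exact: integrableS iK.
  by split; [rewrite -(integral12_prod_meas1 iKD)|rewrite -(integral21_prod_meas1 iKD)].
rewrite -(setvU A) integral_setU ?setvU//; first last.
- by apply/disj_setPS => z [/=].
- exact: measurableC.
rewrite (cut _ mA).1 (cut _ (measurableC mA)).2.
have -> : \int[mu]_s \int[mu]_t (K \_ A) (s, t) =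
    \int[mu]_s \int[mu]_(t in `[s, +oo[) K (s, t).
  apply: eq_integral => s _; rewrite [RHS]integral_mkcond.
  by apply: eq_integral => t _; rewrite !patchE /A !mem_setE /= in_itv/= andbT.
have -> : \int[mu]_t \int[mu]_s (K \_ (~` A)) (s, t) =
    \int[mu]_s \int[mu]_(t in `[s, +oo[) K (s, t).
  apply: eq_integral => t _.
  (* The complement of [A] is the strict half-plane; the missing diagonal meets each section in one
     point, which is Lebesgue-null. *)
  rewrite -integral_itv_obnd_cbnd; last first.
    by apply: measurable_funTS; exact: measurable_fun_pair2.
  rewrite [RHS]integral_mkcond; apply: eq_integral => s _.
  rewrite !patchE /A symK; congr (if _ then _ else _).
  apply/idP/idP; rewrite !inE/= in_itv/= andbT.
    by move/negP; rewrite -ltNge.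
  by rewrite ltNge => /negP.
by rewrite mule_natl mule2n.
Qed.

End symmetric_kernel.

(** * Variance of the estimator *)

Section tails.
Context (R : realType) (Q : probability R R).
Hypothesis lawQ : law_class Q.
Local Notation MR := (measurableTypeR R).
Local Notation mu := (@lebesgue_measure R).

Lemma tailE s : (tail Q s)%:E = Q `]s, +oo[%classic.
Proof. by rewrite /tail fineK// fin_num_measure. Qed.

Lemma tail_ge0 s : 0 <= tail Q s.
Proof. by rewrite -lee_fin tailE. Qed.

Lemma tail_le1 s : tail Q s <= 1.
Proof. by rewrite -lee_fin tailE; exact: probability_le1. Qed.

Lemma tail_nonincreasing : {homo tail Q : s t / s <= t >-> t <= s}.
Proof.
move=> s t st; rewrite -lee_fin !tailE le_measure ?inE//.
by apply: subset_itvr; rewrite bnd_simp.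
Qed.

Lemma measurable_tail : measurable_fun setT (tail Q : MR -> R).
Proof. by apply: nonincreasing_measurable => // s t; exact: tail_nonincreasing. Qed.

(** [law_class] speaks of [s >= 0] only. Monotonicity covers negative [s], so that the inverse tail
    is monotone, hence measurable, on the whole line. *)
Lemma tail_gt0 s : 0 < tail Q s.
Proof.
have [s0|s0] := leP 0 s; first by rewrite -lte_fin tailE; exact: lawQ.2.
rewrite (lt_le_trans _ (tail_nonincreasing (ltW s0)))//.
by rewrite -lte_fin tailE; exact: lawQ.2.
Qed.

Lemma measurable_tailV : measurable_fun setT (fun s : MR => (tail Q s)^-1).
Proof.
apply: nondecreasing_measurable => // s t st.
by rewrite lef_pV2 ?posrE ?tail_gt0//; exact: tail_nonincreasing.
Qed.

(** This is the layer-cake formula. It requires a variable that is non-negative everywhere, whereas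
    [N >= 0] holds only [Q]-almost surely; hence the passage to [Num.max n 0]. *)
Lemma expectation_tail :
  'E_Q[fun n => n]%E = (\int[mu]_(s in `[0%R, +oo[) (tail Q s)%:E)%E.
Proof.
pose X (n : R) : R := Num.max n 0.
have mX : measurable_fun setT X by exact: measurable_maxr.
pose mfX := isMeasurableFun.Build _ _ _ _ X mX.
pose XRV : {RV Q >-> R} := HB.pack_for {mfun R >-> R} X mfX.
have X0 n : 0 <= XRV n by rewrite /= /X le_max lexx orbT.
transitivity ('E_Q[XRV])%E.
  rewrite unlock; apply: ae_eq_integral => //; [exact/measurable_EFinP..|].
  exists (~` `[0, +oo[%classic); split.
  - exact: measurableC.
  - have : Q (~` `[0, +oo[%classic) = 0%E by rewrite probability_setC// lawQ.1 subee.
    exact.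
  - move=> n /=; apply: contra_not => + _; rewrite in_itv/= andbT => n0.
    by rewrite /X max_l.
rewrite ge0_expectation_ccdf//; apply: eq_integral => s.
rewrite inE/= in_itv/= andbT => s0; rewrite tailE /ccdf /distribution /pushforward.
congr (Q _); apply/seteqP; split=> n /=; rewrite !in_itv/= !andbT /X lt_max.
  by move=> /orP[//|]; rewrite ltNge s0.
by move=> ->.
Qed.

End tails.

(** * Mean and second moment of the estimator under the product law *)

Section variance_formula.
Context d (Omega : measurableType d) (R : realType) (P : probability Omega R)
  (E : metricType R) (X : R -> Omega -> E) (g : E -> R -> R).
Hypothesis hg : jointly_measurable X g.
Local Notation MR := (measurableTypeR R).
Local Notation mu := (@lebesgue_measure R).

(** Extension by zero to negative times: measurability then holds on the whole product, and
    integrals over [[0, +oo[] become integrals over the line, to which the product lemmas apply. *)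
Let gz (z : MR * Omega) : R := if 0 <= z.1 then gX X g z.1 z.2 else 0.

Let measurable_gz : measurable_fun setT gz.
Proof.
have mD : measurable (`[0, +oo[%classic `*` setT : set (MR * Omega)).
  by apply: measurableX => //; exact: measurable_itv.
have := (measurable_restrictT _ mD).1 hg; apply: eq_measurable_fun => z _.
rewrite /gz patchE; have -> // : (z \in `[0, +oo[%classic `*` setT) = (0 <= z.1).
by apply/idP/idP; rewrite inE/= in_itv/= andbT => // -[].
Qed.

Variable Q : probability R R.
Hypothesis lawQ : law_class Q.

Let b (t : R) (n : R) : R := \1_(`]t, +oo[%classic) n / tail Q t.

Let b_ge0 t n : 0 <= b t n.
Proof. by rewrite divr_ge0 ?tail_ge0. Qed.

(** Independence factorises the integral, and [b t] has mean 1 under [Q]. The constant [c] is 1 for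
    the mean of the estimator and [(tail Q s)^-1] for its second moment. *)
Let integral_b (a : Omega -> R) (c t : R) : measurable_fun setT a -> 0 <= c ->
  (\int[P \x Q]_x (a x.1 * (c * b t x.2))%:E = \int[P]_w (a w)%:E * c%:E)%E.
Proof.
move=> ma c0.
have mb : measurable_fun setT (fun n => c * b t n).
  by apply: measurable_funM => //; apply: measurable_funM => //; exact: measurable_indic.
have intb : (\int[Q]_n (c * b t n)%:E = c%:E)%E.
  under eq_integral => n _ do rewrite /b mulrCA EFinM.
  have k0 : (0 <= (c / tail Q t)%:E)%E by rewrite lee_fin divr_ge0 ?tail_ge0.
  rewrite ge0_integralZr//; last exact/measurable_EFinP/measurable_indic.
  have -> : (\int[Q]_n (\1_(`]t, +oo[%classic) n)%:E = (tail Q t)%:E)%E.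
    by rewrite integral_indic// setIT tailE.
  rewrite -EFinM.
  by rewrite mulrCA divff ?mulr1// gt_eqF// tail_gt0.
have := @integral_prodM _ _ _ _ _ P Q a (fun n => c * b t n) ma mb.
by rewrite intb => ->// n; exact: mulr_ge0.
Qed.

Let fQ (z : MR * (Omega * R)) : R := gz (z.1, z.2.1) * b z.1 z.2.2.

Let measurable_fQ : measurable_fun setT fQ.
Proof.
apply: measurable_funM.
  apply: (measurableT_comp measurable_gz).
  by apply: measurable_fun_pair => //; exact: measurableT_comp.
apply: measurable_funM; last first.
  exact: (measurableT_comp (measurable_tailV lawQ)).
rewrite (_ : (fun x => _) = (fun x : MR * (Omega * R) =>
    if (x.1 < x.2.2)%R then 1 else 0)); last first.
  apply/funext => x; rewrite indicE.
  have -> : (x.2.2 \in `]x.1, +oo[%classic) = (x.1 < x.2.2).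
    by apply/idP/idP; rewrite inE/= in_itv/= andbT.
  by case: ifP.
apply: measurable_fun_ifT => //; apply: measurable_fun_ltr => //.
exact: measurableT_comp.
Qed.
(** Survival past [t] implies survival past the earlier time [s], so one indicator absorbs the other
    and only the inverse tail at the earlier time is left over. *)
Let b_mul s t n : s <= t -> b s n * b t n = (tail Q s)^-1 * b t n.
Proof.
move=> st; rewrite /b !indicE; have [nt|nt] := boolP (n \in `]t, +oo[%classic).
  rewrite (_ : n \in _) ?div1r// inE/= in_itv/= andbT.
  by move: nt; rewrite inE/= in_itv/= andbT; exact: le_lt_trans.
by rewrite mul0r !mulr0.
Qed.

Let measurable_gz2 (s : MR) : measurable_fun setT (fun w => gz (s, w)).
Proof. exact: measurable_fun_pair2. Qed.

Let fQE s x : fQ (s, x) = gz (s, x.1) * b s x.2. Proof. by []. Qed.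

Let kernelE s t : s <= t ->
  (\int[P \x Q]_x (fQ (s, x) * fQ (t, x))%:E =
   ((tail Q s)^-1)%:E * \int[P]_w (gz (t, w) * gz (s, w))%:E)%E.
Proof.
move=> st; rewrite muleC -(integral_b t) ?invr_ge0 ?tail_ge0//; last exact: measurable_funM.
apply: eq_integral => x _; rewrite -b_mul//; congr (_%:E); rewrite !fQE; ring.
Qed.

Let kernel_absE s t : s <= t ->
  (\int[P \x Q]_x `|(fQ (s, x) * fQ (t, x))%:E| =
   ((tail Q s)^-1)%:E * \int[P]_w (`|gz (s, w) * gz (t, w)|)%:E)%E.
Proof.
move=> st; rewrite muleC -(integral_b t) ?invr_ge0 ?tail_ge0//; last first.
  by apply: measurableT_comp => //; exact: measurable_funM.
apply: eq_integral => x _; rewrite -b_mul//= !fQE normrM 3!(normrM (gz _)).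
by rewrite !(ger0_norm (b_ge0 _ _)); congr (_%:E); ring.
Qed.

Let gz_pos s w : 0 <= s -> gz (s, w) = gX X g s w.
Proof. by rewrite /gz/= => ->. Qed.

Let gz_neg s w : s < 0 -> gz (s, w) = 0.
Proof. by rewrite /gz/= leNgt => ->. Qed.

Let abs_integralE x : (\int[mu]_(s in `[0%R, +oo[)
    (`|gX X g s x.1| * (\1_(`]s, +oo[%classic) x.2 / tail Q s))%:E =
  \int[mu]_s `|(fQ (s, x))%:E|)%E.
Proof.
rewrite integral_mkcond; apply: eq_integral => s _; rewrite patchE mem_setE in_itv/= andbT.
rewrite fQE normrM (ger0_norm (b_ge0 _ _)).
by have [s0|s0] := leP 0 s; [rewrite gz_pos|rewrite gz_neg// normr0 mul0r].
Qed.

Let estimatorE x : estimator X g Q x = \int[mu]_s fQ (s, x).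
Proof.
rewrite /estimator /Rintegral integral_mkcond; congr fine.
apply: eq_integral => s _; rewrite patchE mem_setE in_itv/= andbT fQE.
by have [s0|s0] := leP 0 s; [rewrite gz_pos|rewrite gz_neg// mul0r].
Qed.

Let measurable_abs_kernel :
  measurable_fun setT (fun z : MR * MR => \int[P]_w (`|gz (z.1, w) * gz (z.2, w)|)%:E)%E.
Proof.
apply: (measurable_fun_fubini_tonelli_F (fun x : (MR * MR) * Omega =>
  (`|gz (x.1.1, x.2) * gz (x.1.2, x.2)|)%:E)) => [|x]; last by rewrite lee_fin.
apply/measurable_EFinP; apply: measurableT_comp => //.
by apply: measurable_funM; apply: (measurableT_comp measurable_gz);
  apply: measurable_fun_pair => //; exact: measurableT_comp.
Qed.

Let abs_moment (s : R) : \bar R :=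
  (\int[mu]_(t in `[s, +oo[) 'E_P[fun w => `|gX X g s w * gX X g t w|%R])%E.

Let abs_kernel_gX (s t : R) : 0 <= s -> s <= t ->
  ('E_P[fun w => `|gX X g s w * gX X g t w|%R] =
   \int[P]_w (`|gz (s, w) * gz (t, w)|)%:E)%E.
Proof.
move=> s0 st; rewrite unlock.
by apply: eq_integral => w _; rewrite !gz_pos// (le_trans s0).
Qed.

Let measurable_abs_kernel_gX (s : R) : 0 <= s ->
  measurable_fun `[s, +oo[ (fun t => 'E_P[fun w => `|gX X g s w * gX X g t w|%R])%E.
Proof.
move=> s0; apply: (@eq_measurable_fun _ _ _ _ _
    (fun t : MR => \int[P]_w (`|gz (s, w) * gz (t, w)|)%:E)%E).
  by move=> t; rewrite inE/= in_itv/= andbT => st; rewrite abs_kernel_gX.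
by apply: measurable_funTS; exact: (measurable_fun_pair2 s measurable_abs_kernel).
Qed.

(** The domain of the inner integral moves with [s]. Cutting the kernel off outside the half-plane
    [A] fixes the domain and makes this a section integral, measurable by Tonelli. *)
Lemma measurable_abs_moment : measurable_fun (`[0, +oo[%classic : set MR) abs_moment.
Proof.
pose A : set (MR * MR) := [set z | z.1 <= z.2].
have mA : measurable A.
  have := measurable_fun_ler (@measurable_fst _ _ MR MR) (@measurable_snd _ _ MR MR).
  by move=> /(_ measurableT [set true]); rewrite setTI; exact.
pose K (z : MR * MR) := (\int[P]_w (`|gz (z.1, w) * gz (z.2, w)|)%:E)%E.
have mKA : measurable_fun setT (K \_ A).
  apply: (measurable_restrictT K mA).1; exact: measurable_funTS measurable_abs_kernel.
have KA0 z : (0 <= (K \_ A) z)%E.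
  by apply: erestrict_ge0 => x _; apply: integral_ge0 => w _; rewrite lee_fin.
have := measurable_fun_fubini_tonelli_F (m2 := mu) (K \_ A) mKA KA0.
move=> /(@measurable_funTS _ _ _ _ (`[0, +oo[%classic : set R)); apply: eq_measurable_fun.
move=> s; rewrite inE/= in_itv/= andbT => s0.
rewrite /fubini_F /abs_moment [RHS]integral_mkcond; apply: eq_integral => t _.
rewrite !patchE (_ : ((s, t) \in A) = (s <= t)).
  rewrite mem_setE in_itv/= andbT.
  by case: ifP => // st; rewrite abs_kernel_gX.
by apply/idP/idP; rewrite inE.
Qed.

Lemma Gamma_le_abs_moment s : Gamma_converges P X g -> 0 <= s ->
  ((Gamma P X g s)%:E <= abs_moment s)%E.
Proof.
move=> hconv s0; rewrite /Gamma fineK; last exact: (integrable_fin_num _ (hconv s s0)).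
have /integrableP[mc _] := hconv s s0.
apply: (le_trans (lee_abs _)); apply: (le_trans (le_abse_integral _ _ _)) => //.
apply: ge0_le_integral => //.
- exact: measurableT_comp.
- exact: measurable_abs_kernel_gX.
move=> t /=; rewrite in_itv/= andbT => st; rewrite abs_kernel_gX// unlock.
apply: (@le_trans _ _ (\int[P]_w `|(gz (t, w) * gz (s, w))%:E|)%E).
  rewrite (eq_integral (fun w => (gz (t, w) * gz (s, w))%:E)); last first.
    by move=> w _; rewrite !gz_pos// (le_trans s0).
  by apply: le_abse_integral => //; apply/measurable_EFinP; exact: measurable_funM.
by rewrite le_eqVlt; apply/orP; left; apply/eqP; apply: eq_integral => w _ /=; rewrite mulrC.
Qed.

(** An identity of extended reals that presupposes no finiteness, so it can be used to test whether
    a given law is feasible. *)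
Lemma second_moment_abs :
  (\int[P \x Q]_x (\int[mu]_(s in `[0%R, +oo[)
     (`|gX X g s x.1| * (\1_(`]s, +oo[%classic) x.2 / tail Q s))%:E) ^+ 2 =
   2%:E * \int[mu]_(s in `[0%R, +oo[) (((tail Q s)^-1)%:E *
     \int[mu]_(t in `[s, +oo[) 'E_P[fun w => `|gX X g s w * gX X g t w|%R]))%E.
Proof.
under eq_integral => x _ do rewrite abs_integralE.
rewrite (@integral_sqr_abs _ _ _ _ _ mu (P \x Q)%E _ measurable_fQ).
rewrite integral_symmetric; first last.
- by left=> z; exact: integral_ge0.
- by move=> s t /=; under eq_integral => x _ do rewrite mulrC.
- apply: (measurable_fun_fubini_tonelli_F (fun x : (MR * MR) * (Omega * R) =>
    `|(fQ (x.1.1, x.2) * fQ (x.1.2, x.2))%:E|)%E) => //.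
  apply: measurableT_comp => //; apply/measurable_EFinP.
  by apply: measurable_funM; apply: (measurableT_comp measurable_fQ);
    apply: measurable_fun_pair => //; exact: measurableT_comp.
congr (_ * _)%E; rewrite [RHS]integral_mkcond; apply: eq_integral => s _.
rewrite patchE mem_setE in_itv/= andbT; have [s0|s0] := leP 0 s; last first.
  apply: integral0_eq => t _; apply: integral0_eq => x _.
  by rewrite !fQE gz_neg// mul0r mul0r normr0.
rewrite -ge0_integralZl//; first last.
- by rewrite lee_fin invr_ge0 tail_ge0.
- by move=> t _; exact: expectation_ge0.
- exact: measurable_abs_kernel_gX.
apply: eq_integral => t; rewrite inE/= in_itv/= andbT => st.
by rewrite kernel_absE// abs_kernel_gX.
Qed.

Lemma GammaE s : Gamma_converges P X g -> 0 <= s ->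
  ((Gamma P X g s)%:E =
   \int[mu]_(t in `[s, +oo[) 'E_P[fun w => (gX X g t w * gX X g s w)%R])%E.
Proof.
move=> hconv s0; rewrite /Gamma fineK//.
exact: (integrable_fin_num _ (hconv s s0)).
Qed.

Lemma estimator_varianceE :
  Gamma_converges P X g -> estimator_abs_L2 P X g Q ->
  (estimator_variance P X g Q =
   2%:E * \int[mu]_(s in `[0%R, +oo[) (Gamma P X g s / tail Q s)%:E -
   (alpha P X g ^+ 2)%:E)%E.
Proof.
move=> hconv; rewrite /estimator_abs_L2.
under eq_integral => x _ do rewrite abs_integralE.
move=> L2fin.
have intf := integrable_sqr_abs_lty measurable_fQ L2fin.
have [intK intsqr sqrE] := integral_sqr_signed measurable_fQ L2fin.
have estE : estimator X g Q = (fun x => \int[mu]_s fQ (s, x)).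
  by apply/funext => x; exact: estimatorE.
have [mest meanE] := Rintegral_mean intf.
have int1 : (P \x Q)%E.-integrable setT (EFin \o estimator X g Q).
  apply: eq_integrable (integrable_Rintegral measurable_fQ L2fin) => // x _ /=.
  by rewrite -estimatorE.
(* The estimator is unbiased: averaging [b s] over [N] replaces it by its mean 1 and leaves the time
   integral of the process. *)
have meanP : ('E_(P \x Q)[estimator X g Q] = (alpha P X g)%:E)%E.
  have marg (a : Omega -> R) s : measurable_fun setT a ->
      (\int[P \x Q]_x (a x.1 * b s x.2)%:E = \int[P]_w (a w)%:E)%E.
    move=> ma; rewrite -[RHS]mule1 -(integral_b s ma ler01).
    by apply: eq_integral => x _; rewrite mul1r.
  (* Integrability of the process is inherited from [fQ], since averaging [|gz| * b] over [N] gives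
     back [|gz|]. *)
  have intgz : (mu \x P)%E.-integrable setT (EFin \o gz).
    apply/integrable12ltyP; first exact/measurable_EFinP.
    have mfQ' : measurable_fun setT (EFin \o fQ) by exact/measurable_EFinP.
    rewrite (le_lt_trans _ ((integrable12ltyP _ _ mfQ').1 intf))//.
    rewrite le_eqVlt; apply/orP; left; apply/eqP; apply: eq_integral => s _.
    rewrite -(marg (fun w => `|gz (s, w)|) s); last exact: measurableT_comp.
    by apply: eq_integral => x _ /=; rewrite normrM (ger0_norm (b_ge0 _ _)).
  have [_ meangz] := Rintegral_mean intgz.
  (* [alpha] is the [fine] part of [A]; equality with the finite mean of the estimator shows that
     nothing is lost by [fine]. *)
  rewrite /alpha; set A := 'E_P[_]%E; suff meanA : 'E_(P \x Q)[estimator X g Q]%E = A.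
    by rewrite -meanA fineK// unlock; exact: integrable_fin_num int1.
  rewrite /A unlock; under eq_integral => x _ do rewrite estimatorE.
  rewrite meanE; transitivity (\int[P]_w (\int[mu]_s gz (s, w))%:E)%E.
    by rewrite meangz; apply: eq_integral => s _; rewrite -(marg _ s).
  apply: eq_integral => w _; rewrite /Rintegral [in RHS]integral_mkcond.
  congr (_%:E); congr fine; apply: eq_integral => s _.
  rewrite patchE mem_setE in_itv/= andbT.
  by have [s0|s0] := leP 0 s; [rewrite gz_pos|rewrite gz_neg].
have sqrP : ('E_(P \x Q)[estimator X g Q * estimator X g Q] =
    2%:E * \int[mu]_(s in `[0%R, +oo[) (Gamma P X g s / tail Q s)%:E)%E.
  rewrite unlock.
  transitivity (\int[(P \x Q)%E]_x ((\int[mu]_s fQ (s, x)) ^+ 2)%:E)%E.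
    by apply: eq_integral => x _; rewrite -estimatorE expr2.
  rewrite sqrE integral_symmetric; first last.
  - by right.
  - by move=> s t /=; under eq_integral => x _ do rewrite mulrC.
  - by have /integrableP[] := intK.
  congr (_ * _)%E; rewrite [RHS]integral_mkcond; apply: eq_integral => s _.
  rewrite patchE mem_setE in_itv/= andbT; have [s0|s0] := leP 0 s; last first.
    apply: integral0_eq => t _; apply: integral0_eq => x _.
    by rewrite !fQE gz_neg// mul0r mul0r.
  rewrite mulrC EFinM GammaE// -integralZl//; last exact: hconv.
  apply: eq_integral => t; rewrite inE/= in_itv/= andbT => st.
  rewrite kernelE// unlock; congr (_ * _)%E.
  by apply: eq_integral => w _; rewrite !gz_pos// (le_trans s0).
rewrite /estimator_variance /variance covarianceE; first by rewrite sqrP meanP -EFinM expr2.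
- exact/Lfun1_integrable.
- exact/Lfun1_integrable.
- apply/Lfun1_integrable; apply: eq_integrable intsqr => // x _ /=.
  by rewrite -estimatorE expr2.
Qed.

End variance_formula.

(** * Laws with a prescribed tail *)

Lemma lipschitz_continuous_at (R : realType) (f : R -> R) (s k r : R) : 0 < r ->
  (forall y, `|y - s| < r -> `|f y - f s| <= k * `|y - s|) -> {for s, continuous f}.
Proof.
move=> r0 H; apply/cvgrPdist_lt => e e0.
near=> y.
have ys : `|y - s| < r by rewrite distrC; near: y; apply: cvgr_dist_lt => //; exact: cvg_id.
rewrite distrC (le_lt_trans (H _ ys))//.
have k0 : 0 < `|k| + 1 by rewrite ltr_wpDl.
have ys' : `|y - s| < e / (`|k| + 1).
  by rewrite distrC; near: y; apply: cvgr_dist_lt; [exact: cvg_id|rewrite divr_gt0].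
rewrite (@le_lt_trans _ _ ((`|k| + 1) * `|y - s|))//.
  by rewrite ler_wpM2r// (le_trans (ler_norm _))// lerDl.
by rewrite mulrC -ltr_pdivlMr.
Unshelve. all: by end_near. Qed.

Lemma max0_lipschitz (R : realType) (x y : R) :
  `|Num.max x 0 - Num.max y 0| <= `|x - y|.
Proof.
have := ler_norm (x - y); have := ler_norm (y - x); rewrite distrC ler_norml.
by case: (leP x 0) => x0; case: (leP y 0) => y0 h1 h2; apply/andP; split; lra.
Qed.

(** Near [p] the difference quotients taken inside the half-line lie within 1 of [F 1 p], which
    gives a Lipschitz bound at [p]. Composing with the 1-Lipschitz map [Num.max s 0] turns one-sided
    continuity at 0 into continuity on the whole line; the same device recurs below. *)
Lemma smooth_on_continuous (R : realType) (f : R -> R) :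
  smooth_on `[0, +oo[%classic f -> continuous (fun s : R => f (Num.max s 0)).
Proof.
move=> [F [F0 dF]] s; set p := Num.max s 0.
have pos (x : R) : `[0, +oo[%classic (Num.max x 0).
  by rewrite /= in_itv/= andbT le_max lexx orbT.
have /cvgrPdist_lt/(_ 1 ltr01) := dF 0 p (pos s).
rewrite near_withinE => /nbhs_ballP[r /= r0 Hr].
apply: (@lipschitz_continuous_at _ _ _ (`|F 1 p| + 1) r r0) => y ys.
set q := Num.max y 0; rewrite -/p.
have qp : `|q - p| <= `|y - s| by exact: max0_lipschitz.
rewrite (le_trans _ (ler_wpM2l _ qp)) ?addr_ge0//.
have [->|qnp] := eqVneq q p; first by rewrite !subrr normr0 mulr0.
have := Hr q; rewrite /ball/= distrC => /(_ (le_lt_trans qp ys)).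
move=> /(_ (conj (pos y) (elimN eqP qnp))); rewrite (F0 _ (pos y)) (F0 _ (pos s)) -/p -/q => H.
have qp0 : 0 < `|q - p| by rewrite normr_gt0 subr_eq0.
rewrite -ler_pdivrMr// -normf_div.
rewrite -[X in `|X| <= _](subrK (F 1 p)) (le_trans (ler_normD _ _))// addrC lerD2l.
by rewrite distrC ltW.
Qed.

(** [1 - q], continued by 0 to the left of 0, is a distribution function, and its Lebesgue-Stieltjes
    measure is the law. It may jump at 0: when [q 0 < 1] the law has an atom there. *)
Lemma exists_law (R : realType) (q : R -> R) :
  continuous (fun s : R => q (Num.max s 0)) ->
  (forall s t, 0 <= s -> s <= t -> q t <= q s) ->
  (forall s, 0 <= s -> 0 < q s <= 1) ->
  q s @[s --> +oo] --> 0 ->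
  exists Q : probability R R, law_class Q /\ forall s, 0 <= s -> tail Q s = q s.
Proof.
move=> qcont qdec q01 qlim.
pose F (s : R) : R := if 0 <= s then 1 - q s else 0.
have F_ge0 s : 0 <= s -> 0 <= F s by move=> s0; rewrite /F s0; have := q01 s s0; lra.
have Fnd : nondecreasing F.
  move=> s t st; have [s0|s0] := leP 0 s.
    by rewrite /F s0 (le_trans s0 st); have := qdec s t s0 st; lra.
  rewrite [F s]/F (leNgt 0 s) s0/=; have [t0|t0] := leP 0 t; first exact: F_ge0.
  by rewrite /F (leNgt 0 t) t0.
have Frc : right_continuous F.
  move=> x; have [x0|x0] := leP 0 x; last first.
    apply: (@cvg_trans _ (cst 0 @ x^'+)); last by rewrite /F leNgt x0; exact: cvg_cst.
    apply: near_eq_cvg; near=> y.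
    have y0 : y < 0 by near: y; exact: nbhs_right_lt.
    by rewrite /F leNgt y0.
  have Fc : {for x, continuous (fun s : R => 1 - q (Num.max s 0))}.
    by apply: continuousB; [exact: cvg_cst|exact: qcont].
  have -> : F x = 1 - q (Num.max x 0) by rewrite /F x0 max_l.
  apply: (@cvg_trans _ ((fun s : R => 1 - q (Num.max s 0)) @ x^'+)); last first.
    exact: cvg_at_right_filter Fc.
  apply: near_eq_cvg; near=> y.
  have y0 : 0 <= y by rewrite (le_trans x0)//; near: y; exact: nbhs_right_ge.
  by rewrite /F y0 max_l.
have FNy : F @ -oo --> (0 : R).
  apply: (@cvg_trans _ (cst 0 @ -oo)); last exact: cvg_cst.
  apply: near_eq_cvg; near=> y.
  have y0 : y < 0 by near: y; exact: nbhs_ninfty_lt.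
  by rewrite /F leNgt y0.
have Fy : F @ +oo --> (1 : R).
  apply: (@cvg_trans _ ((fun s : R => 1 - q s) @ +oo)).
    apply: near_eq_cvg; near=> y.
    have y0 : 0 <= y by near: y; exact: nbhs_pinfty_ge.
    by rewrite /F y0.
  have := cvgB (cvg_cst (1 : R)) qlim; rewrite subr0; exact.
pose F1 := isCumulative.Build R _ R F Fnd Frc.
pose F2 := isCumulativeBounded.Build R 0 1 F FNy Fy.
pose FC : cumulativeBounded (0 : R) (1 : R) := HB.pack F F1 F2.
pose mT := measurableTypeR R.
(* Pushing forward by [Num.max n 0] makes the mass of [[0, +oo[] equal to 1 by construction and
   leaves the tails at [s >= 0] unchanged. *)
pose X (n : mT) : R := Num.max n 0.
have mX : measurable_fun setT X.
  by apply: measurable_maxr => //; exact: measurable_id.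
pose XRV : {mfun mT >-> R} := HB.pack X (isMeasurableFun.Build _ _ _ _ X mX).
pose Q : probability R R := distribution (lebesgue_stieltjes_measure FC) XRV.
have Qtail s : 0 <= s -> Q `]s, +oo[%classic = (q s)%:E.
  move=> s0; pose idT : mT -> R := idfun.
  pose idRV : {RV lebesgue_stieltjes_measure FC >-> R} :=
    HB.pack idT (isMeasurableFun.Build _ _ _ _ idT (@measurable_id _ _ setT)).
  transitivity (ccdf idRV s).
    rewrite /Q /ccdf /distribution /= /pushforward; congr (lebesgue_stieltjes_measure _ _).
    apply/seteqP; split=> n /=; rewrite !in_itv/= !andbT /X lt_max.
      by move=> /orP[//|]; rewrite ltNge s0.
    by move=> ->.
  have := cdf_lebesgue_stieltjes_id FC s; rewrite ccdf_1_cdf => ->.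
  by rewrite -EFinB /= /F s0 subKr.
exists Q; split; last by move=> s s0; rewrite /tail Qtail.
split; last by move=> s s0; rewrite Qtail// lte_fin; have /andP[] := q01 s s0.
rewrite /Q /distribution /= /pushforward.
rewrite (_ : XRV @^-1` _ = setT) ?probability_setT//.
by apply/seteqP; split => // x _ /=; rewrite in_itv/= andbT le_max lexx orbT.
Unshelve. all: by end_near. Qed.

(** * The optimal tail *)

Section optimal_tail.
Context (R : realType) (G : R -> R).
Local Notation mu := (@lebesgue_measure R).
Local Notation sqrtG := (fun s : R => Num.sqrt (G s)).
Local Notation D := (`[0, +oo[%classic : set R).
Hypothesis Gge0 : forall s, 0 <= s -> 0 <= G s.
Hypothesis Gdecr : forall s t, 0 <= s -> s < t -> G t < G s.
Hypothesis Gcont : continuous (fun s : R => G (Num.max s 0)).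
Hypothesis intsG : mu.-integrable `[0, +oo[ (EFin \o sqrtG).

Let I (s : R) : R := \int[mu]_(u in `[s, +oo[) Num.sqrt (G u).

(** Strict decrease upgrades non-negativity: [G s] lies strictly above [G (s + 1) >= 0]. *)
Lemma decreasing_gt0 s : 0 <= s -> 0 < G s.
Proof.
move=> s0; rewrite (@le_lt_trans _ _ (G (s + 1)))//; last by rewrite Gdecr// ltrDl.
by rewrite Gge0// addr_ge0.
Qed.

Lemma decreasing_noninc s t : 0 <= s -> s <= t -> G t <= G s.
Proof.
by move=> s0; rewrite le_eqVlt => /predU1P[->//|st]; rewrite ltW// Gdecr.
Qed.

Lemma sqrt_decreasing_gt0 s : 0 <= s -> 0 < Num.sqrt (G s).
Proof. by move=> s0; rewrite sqrtr_gt0 decreasing_gt0. Qed.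

Lemma sqrt_decreasing_noninc s t : 0 <= s -> s <= t -> Num.sqrt (G t) <= Num.sqrt (G s).
Proof. by move=> s0 st; rewrite ler_wsqrtr// decreasing_noninc. Qed.

Let int_itv (i : interval R) : [set` i] `<=` `[0, +oo[%classic ->
  mu.-integrable [set` i] (EFin \o sqrtG).
Proof. by move=> i0; apply: integrableS intsG. Qed.

Let I_split s t : 0 <= s -> s <= t ->
  I s = \int[mu]_(u in `[s, t]) Num.sqrt (G u) + I t.
Proof.
move=> s0 st; have i1 : mu.-integrable `[s, +oo[ (EFin \o sqrtG).
  by apply: int_itv; apply: subset_itvr; rewrite bnd_simp.
have := Rintegral_itvB (x := t) i1; rewrite !bnd_simp => /(_ st isT).
rewrite Rintegral_itv_obnd_cbnd; first by rewrite /I => <-; rewrite addrC subrK.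
by apply: int_itv; apply: subset_itvr; rewrite bnd_simp (le_trans s0).
Qed.

Let itv_bounds s t : 0 <= s -> s <= t ->
  (t - s) * Num.sqrt (G t) <= \int[mu]_(u in `[s, t]) Num.sqrt (G u) <=
  (t - s) * Num.sqrt (G s).
Proof.
move=> s0 st; have i1 : mu.-integrable `[s, t] (EFin \o sqrtG).
  by apply: int_itv => u /=; rewrite !in_itv/= andbT => /andP[+ _]; exact: le_trans.
have cstE (c : R) : (\int[mu]_(u in `[s, t]) c%:E = ((t - s) * c)%:E)%E.
  rewrite integral_cst//= lebesgue_measure_itv/= lte_fin muleC.
  have [_|ts] := ltP s t; first by rewrite EFinM.
  by rewrite (@le_anti _ _ s t) ?st// subrr mul0e mul0r.
have IE : ((\int[mu]_(u in `[s, t]) Num.sqrt (G u))%:E =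
    \int[mu]_(u in `[s, t]) (Num.sqrt (G u))%:E)%E.
  by rewrite /Rintegral fineK//; exact: integrable_fin_num i1.
have mi : measurable_fun `[s, t] (fun u => (Num.sqrt (G u))%:E).
  by have /integrableP[] := i1.
rewrite -!lee_fin IE -!cstE; apply/andP; split; apply: ge0_le_integral => //.
- move=> u /=; rewrite in_itv/= => /andP[su ut].
  by rewrite lee_fin sqrt_decreasing_noninc// (le_trans s0).
- move=> u /=; rewrite in_itv/= => /andP[su ut].
  by rewrite lee_fin sqrt_decreasing_noninc.
Qed.

Lemma int_sqrt_ge0 s : 0 <= I s.
Proof. by apply: Rintegral_ge0 => u _; exact: sqrtr_ge0. Qed.

Lemma int_sqrt_gt0 s : 0 <= s -> 0 < I s.
Proof.
move=> s0; have s1 : s <= s + 1 by rewrite lerDl.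
rewrite (I_split s0 s1); have /andP[+ _] := itv_bounds s0 s1.
have := int_sqrt_ge0 (s + 1).
have : 0 < Num.sqrt (G (s + 1)) by rewrite sqrt_decreasing_gt0// addr_ge0.
have -> : s + 1 - s = 1 by ring.
by rewrite mul1r; lra.
Qed.


(* [s + I s / sqrt (G s)] is the mean of the law with tail
   [min 1 (sqrt (G u / G s))]. *)
Let h (s : R) : R := s + I s / Num.sqrt (G s).

(** No derivative is taken. After division by [sqrt (G s)] the integral over [[s, t]] is at most
    [t - s], which the first summand of [h] compensates; strictness comes from dividing [I t > 0] by
    the smaller [sqrt (G t)]. *)
Let h_incr s t : 0 <= s -> s < t -> h s < h t.
Proof.
move=> s0 st; have t0 : 0 <= t by rewrite (le_trans s0)// ltW.
have /andP[_ ub] := itv_bounds s0 (ltW st).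
rewrite /h (I_split s0 (ltW st)) mulrDl.
have sG0 := sqrt_decreasing_gt0 s0.
have A : (\int[mu]_(u in `[s, t]) Num.sqrt (G u)) / Num.sqrt (G s) <= t - s.
  by rewrite ler_pdivrMr.
have B : I t / Num.sqrt (G s) < I t / Num.sqrt (G t).
  rewrite ltr_pM2l ?int_sqrt_gt0// ltf_pV2 ?posrE ?sqrt_decreasing_gt0// ltr_sqrt ?decreasing_gt0//.
  exact: Gdecr.
lra.
Qed.

Let h_continuous : continuous (fun s : R => h (Num.max s 0)).
Proof.
have max0 (x : R) : 0 <= Num.max x 0 by rewrite le_max lexx orbT.
move=> s; rewrite /h.
have sGc : {for s, continuous (fun x : R => Num.sqrt (G (Num.max x 0)))}.
  by apply: continuous_comp; [exact: Gcont|exact: sqrt_continuous].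
apply: cvgD.
  apply: (@lipschitz_continuous_at _ (fun x : R => Num.max x 0) s 1 1 ltr01) => y _.
  by rewrite mul1r max0_lipschitz.
apply: cvgM.
  (* [I] is Lipschitz with constant [sqrt (G 0)], the largest value of its integrand. *)
  apply: (@lipschitz_continuous_at _ (fun x : R => I (Num.max x 0)) s
    (Num.sqrt (G 0)) 1 ltr01) => y _.
  rewrite (le_trans _ (ler_wpM2l _ (max0_lipschitz _ _))) ?sqrtr_ge0//.
  wlog yx : s y {sGc} / Num.max s 0 <= Num.max y 0 => [hw|].
    have [|/ltW yx] := leP (Num.max s 0) (Num.max y 0); first exact: hw.
    by rewrite distrC [X in _ * X]distrC; exact: hw.
  have /andP[lb ub] := itv_bounds (max0 s) yx.
  rewrite (I_split (max0 s) yx) opprD addrCA subrr addr0 normrN ger0_norm; last first.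
    by apply: Rintegral_ge0 => u _; exact: sqrtr_ge0.
  rewrite ger0_norm ?subr_ge0// mulrC (le_trans ub)// ler_wpM2l ?subr_ge0//.
  exact: sqrt_decreasing_noninc.
apply: cvgV; first by rewrite gt_eqF// sqrt_decreasing_gt0.
exact: sGc.
Qed.

(** The intermediate value theorem applies to [h] on [[0, m]]: [h 0 < m] is the hypothesis, and
    [h m > m] because [I m > 0]. The first inequality also excludes the root 0, and [h_incr] gives
    uniqueness. *)
Lemma saturation_point_exists m : I 0 / Num.sqrt (G 0) < m ->
  exists s, unique (fun s => 0 < s /\ s + I s / Num.sqrt (G s) = m) s.
Proof.
move=> hm; have h0 : h 0 < m by rewrite /h add0r.
have m0 : 0 < m by rewrite (le_lt_trans _ hm)// divr_ge0 ?int_sqrt_ge0 ?sqrtr_ge0.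
have hmm : m < h m by rewrite ltrDl divr_gt0 ?int_sqrt_gt0 ?sqrt_decreasing_gt0// ltW.
have [||c] := @IVT R (fun s : R => h (Num.max s 0)) 0 m m (ltW m0).
- by apply: continuous_subspaceT; exact: h_continuous.
- have -> : Num.max 0 0 = 0 :> R by rewrite maxxx.
  rewrite (max_l (ltW m0)).
  by rewrite ge_min le_max (ltW h0) (ltW hmm) orbT.
rewrite in_itv/= => /andP[c0 _]; rewrite max_l// => hc.
have cpos : 0 < c.
  by rewrite lt_neqAle c0 andbT; apply: contraTneq h0 => ->; rewrite hc ltxx.
exists c; split=> // c' [c'0 hc']; move: hc; rewrite -hc' => /eqP.
case: (ltgtP c c') => // cc' /eqP hcc'.
  by have := h_incr c0 cc'; rewrite hcc' ltxx.
by have := h_incr (ltW c'0) cc'; rewrite hcc' ltxx.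
Qed.

Let measurable_nneg (f : R -> R) :
  measurable_fun setT (fun s : R => f (Num.max s 0)) ->
  measurable_fun D f.
Proof.
move=> mf; have : measurable_fun D (fun s : R => f (Num.max s 0)).
  exact: measurable_funTS.
by apply: eq_measurable_fun => s; rewrite inE/= in_itv/= andbT => s0; rewrite max_l.
Qed.

Lemma measurable_decreasing : measurable_fun D G.
Proof. by apply: measurable_nneg; exact: continuous_measurable_fun. Qed.

Lemma measurable_sqrt_decreasingV : measurable_fun D (fun s => (Num.sqrt (G s))^-1).
Proof.
have max0 (x : R) : 0 <= Num.max x 0 by rewrite le_max lexx orbT.
apply: measurable_nneg; apply: nondecreasing_measurable => // s t st.
rewrite lef_pV2 ?posrE ?sqrt_decreasing_gt0// sqrt_decreasing_noninc//.
by rewrite ge_max !le_max st lexx !orbT.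
Qed.

Definition opt_tail (lam s : R) : R := Num.min 1 (Num.sqrt (G s / lam)).

(** * The capped tail at a fixed level [lam] *)

Section level.
Variable lam : R.
Hypothesis lam0 : 0 < lam.

Lemma opt_tail_gt0 s : 0 <= s -> 0 < opt_tail lam s.
Proof. by move=> s0; rewrite lt_min ltr01 sqrtr_gt0 divr_gt0 ?decreasing_gt0. Qed.

Lemma opt_tail_le1 s : opt_tail lam s <= 1.
Proof. by rewrite ge_min lexx. Qed.

Lemma opt_tail_noninc s t : 0 <= s -> s <= t -> opt_tail lam t <= opt_tail lam s.
Proof.
move=> s0 st; rewrite le_min opt_tail_le1/= ge_min.
by rewrite (ler_wsqrtr (ler_wpM2r _ (decreasing_noninc s0 st))) ?orbT// invr_ge0 ltW.
Qed.

Let opt_tail_continuous : continuous (fun s : R => opt_tail lam (Num.max s 0)).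
Proof.
move=> s; have gc : {for s, continuous (fun x : R => Num.sqrt (G (Num.max x 0) / lam))}.
  apply: continuous_comp; last exact: sqrt_continuous.
  by apply: cvgMl; exact: Gcont.
exact: (@continuous_min _ _ (cst 1) _ s (cvg_cst _) gc).
Qed.

Lemma opt_tail_law :
  exists Q : probability R R,
    law_class Q /\ forall s, 0 <= s -> tail Q s = opt_tail lam s.
Proof.
apply: exists_law.
- exact: opt_tail_continuous.
- exact: opt_tail_noninc.
- by move=> s s0; rewrite opt_tail_gt0// opt_tail_le1.
apply/cvgrPdist_lt => e e0; near=> s.
have s0 : 0 < s by near: s; exact: nbhs_pinfty_gt.
(* The threshold comes from [s * sqrt (G s) <= I 0]: a decreasing integrand on [[0, s]] is at least
   its value at [s]. *)
have sb : I 0 / (Num.sqrt lam * e) < s by near: s; apply: nbhs_pinfty_gt; rewrite num_real.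
rewrite sub0r normrN ger0_norm ?(ltW (opt_tail_gt0 (ltW s0)))//.
rewrite /opt_tail gt_min; apply/orP; right.
rewrite sqrtrM ?Gge0 ?(ltW s0)// sqrtrV ?(ltW lam0)//.
have sl : 0 < Num.sqrt lam by rewrite sqrtr_gt0.
rewrite ltr_pdivrMr//; have /andP[+ _] := itv_bounds (lexx 0) (ltW s0).
have := int_sqrt_ge0 s; have := I_split (lexx 0) (ltW s0); rewrite subr0 => Is Is0 lb.
rewrite -(ltr_pM2l s0) (le_lt_trans lb)// (@le_lt_trans _ _ (I 0))//.
  by rewrite Is lerDl.
by move: sb; rewrite ltr_pdivrMr ?mulr_gt0// [e * _]mulrC.
Unshelve. all: by end_near. Qed.

(** With [G s = lam * x ^ 2] the gap between the sides factors: it is [lam * (x - q) ^ 2 / q] when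
    the cap is inactive, and [lam * (1 - q) * (x ^ 2 - q) / q] when it is active, where
    [q <= 1 <= x ^ 2]. *)
Lemma opt_tail_min s q : 0 <= s -> 0 < q <= 1 ->
  G s / opt_tail lam s + lam * opt_tail lam s <= G s / q + lam * q.
Proof.
move=> s0 /andP[q0 q1]; rewrite /opt_tail; set x := Num.sqrt _.
have x0 : 0 < x by rewrite sqrtr_gt0 divr_gt0 ?decreasing_gt0.
have -> : G s = lam * x ^+ 2.
  by rewrite sqr_sqrtr ?divr_ge0 ?Gge0 ?(ltW lam0)// mulrC divfK// gt_eqF.
have [x1|x1] := leP 1 x.
  rewrite -subr_ge0.
  have -> : lam * x ^+ 2 / q + lam * q - (lam * x ^+ 2 / 1 + lam * 1) =
      lam * ((1 - q) * (x ^+ 2 - q)) / q by field; rewrite gt_eqF.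
  apply: divr_ge0; last exact: ltW.
  apply: mulr_ge0; first exact: ltW.
  by apply: mulr_ge0; nra.
rewrite -subr_ge0.
have -> : lam * x ^+ 2 / q + lam * q - (lam * x ^+ 2 / x + lam * x) =
    lam * (x - q) ^+ 2 / q by field; rewrite !gt_eqF.
apply: divr_ge0; last exact: ltW.
by apply: mulr_ge0; [exact: ltW|exact: sqr_ge0].
Qed.

Lemma measurable_opt_tail : measurable_fun D (opt_tail lam).
Proof.
by apply: measurable_nneg; exact: continuous_measurable_fun opt_tail_continuous.
Qed.

Lemma measurable_opt_tailV : measurable_fun D (fun s => (opt_tail lam s)^-1).
Proof.
have max0 (x : R) : 0 <= Num.max x 0 by rewrite le_max lexx orbT.
apply: measurable_nneg; apply: nondecreasing_measurable => // s t st.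
rewrite lef_pV2 ?posrE ?opt_tail_gt0// opt_tail_noninc//.
by rewrite ge_max !le_max st lexx !orbT.
Qed.

Lemma opt_tail_optimal (m : R) (Q : probability R R) : law_class Q ->
  (\int[mu]_(s in `[0%R, +oo[) (tail Q s)%:E = m%:E)%E ->
  (\int[mu]_(s in `[0%R, +oo[) (opt_tail lam s)%:E = m%:E)%E ->
  (\int[mu]_(s in `[0%R, +oo[) (G s / opt_tail lam s)%:E <=
   \int[mu]_(s in `[0%R, +oo[) (G s / tail Q s)%:E)%E.
Proof.
move=> lawQ mQ mopt.
have addl (p : R -> R) : measurable_fun D p ->
    measurable_fun D (fun s => (p s)^-1) -> (forall s, 0 <= s -> 0 <= p s) ->
    (\int[mu]_(s in `[0%R, +oo[) (p s)%:E = m%:E)%E ->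
    (\int[mu]_(s in `[0%R, +oo[) (G s / p s)%:E + (lam * m)%:E =
     \int[mu]_(s in `[0%R, +oo[) (G s / p s + lam * p s)%:E)%E.
  move=> mp mpV p0 pm; under [RHS]eq_integral => s _ do rewrite EFinD (EFinM lam).
  rewrite ge0_integralD//.
  - by rewrite ge0_integralZl// ?pm ?lee_fin ?(ltW lam0)//;
      [exact/measurable_EFinP|move=> s /=; rewrite in_itv/= andbT lee_fin; exact: p0].
  - move=> s /=; rewrite in_itv/= andbT => s0.
    by rewrite lee_fin divr_ge0 ?Gge0 ?p0.
  - by apply/measurable_EFinP; apply: measurable_funM => //; exact: measurable_decreasing.
  - move=> s /=; rewrite in_itv/= andbT => s0.
    by rewrite mule_ge0 ?lee_fin ?p0 ?(ltW lam0).
  - by apply: emeasurable_funM => //; exact/measurable_EFinP.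
have mtQ := measurable_tail Q; have mtQV := measurable_tailV lawQ.
(* The added constant is finite, so it cancels even if the integral for [Q] is infinite. *)
rewrite -(@leeD2rE _ (lam * m)%:E)// !addl//; last first.
- by move=> s s0; rewrite ltW// opt_tail_gt0.
- exact: measurable_opt_tailV.
- exact: measurable_opt_tail.
- by move=> s _; exact: tail_ge0.
- exact: measurable_funTS.
- exact: measurable_funTS.
have msum (p : R -> R) : measurable_fun D p -> measurable_fun D (fun s => (p s)^-1) ->
    measurable_fun D (fun s => (G s / p s + lam * p s)%:E).
  move=> mp mpV; apply/measurable_EFinP; apply: measurable_funD.
    by apply: measurable_funM => //; exact: measurable_decreasing.
  exact: measurable_funM.
apply: ge0_le_integral => //.
- move=> s /=; rewrite in_itv/= andbT => s0; rewrite lee_fin.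
  have p0 := ltW (opt_tail_gt0 s0).
  by rewrite addr_ge0 ?mulr_ge0 ?invr_ge0 ?Gge0 ?(ltW lam0).
- by apply: msum; [exact: measurable_opt_tail|exact: measurable_opt_tailV].
- by apply: msum; exact: measurable_funTS.
- move=> s /=; rewrite in_itv/= andbT => s0; rewrite lee_fin opt_tail_min//.
  by rewrite tail_gt0// tail_le1.
Qed.

End level.

Let integral_scaled_sqrtG c s (b : bool) : 0 <= c -> 0 <= s ->
  (\int[mu]_(u in [set` Interval (BSide b s) +oo%O]) (c * Num.sqrt (G u))%:E =
   (c * I s)%:E)%E.
Proof.
move=> c0 s0.
have i1 : mu.-integrable `[s, +oo[ (EFin \o sqrtG).
  by apply: int_itv; apply: subset_itvr; rewrite bnd_simp.
have m1 : measurable_fun `[s, +oo[ (fun u => (c * Num.sqrt (G u))%:E).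
  have /integrableP[m1 _] := i1.
  by apply/measurable_EFinP; apply: measurable_funM => //; exact/measurable_EFinP.
transitivity (\int[mu]_(u in `[s, +oo[) (c * Num.sqrt (G u))%:E)%E.
  case: b => //; apply: integral_itv_obnd_cbnd.
  by apply: measurable_funS m1 => //; apply: subset_itvr; rewrite bnd_simp.
under eq_integral => u _ do rewrite EFinM.
rewrite integralZl// EFinM /I /Rintegral fineK//.
exact: integrable_fin_num i1.
Qed.

(** [G] is dominated by [sqrt (G 0) * sqrt G]. *)
Lemma integrable_decreasing : mu.-integrable D (EFin \o G).
Proof.
have i0 : mu.-integrable D (fun s => (Num.sqrt (G 0))%:E * (Num.sqrt (G s))%:E)%E.
  exact: integrableZl.
apply: (le_integrable _ _ _ i0) => //.
  by apply/measurable_EFinP; exact: measurable_decreasing.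
move=> s /=; rewrite in_itv/= andbT => s0; rewrite lee_fin.
rewrite !ger0_norm ?mulr_ge0 ?sqrtr_ge0 ?Gge0//.
by rewrite -{1}(sqr_sqrtr (Gge0 s0)) expr2 ler_wpM2r ?sqrtr_ge0// sqrt_decreasing_noninc.
Qed.

(** At level [G s] monotonicity puts the capped region at [[0, s]]; beyond it both integrands are
    constant multiples of [sqrt G]. *)
Lemma opt_tail_integrals_saturated (m s : R) : 0 <= s -> s + I s / Num.sqrt (G s) = m ->
  (\int[mu]_(u in D) (opt_tail (G s) u)%:E = m%:E)%E /\
  (\int[mu]_(u in D) (G u / opt_tail (G s) u)%:E =
   (\int[mu]_(u in `[0%R, s]) G u + G s * (m - s))%:E)%E.
Proof.
move=> s0 hm; have G0 := decreasing_gt0 s0; have sG0 := sqrt_decreasing_gt0 s0.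
have split_s (f : R -> R) : measurable_fun D f -> (forall u, 0 <= u -> 0 <= f u) ->
    (\int[mu]_(u in D) (f u)%:E =
     \int[mu]_(u in `[0%R, s]) (f u)%:E + \int[mu]_(u in `]s, +oo[) (f u)%:E)%E.
  move=> mf f0.
  have DE : D = `[0, s]%classic `|` `]s, +oo[%classic.
    by rewrite -itv_bndbnd_setU// bnd_simp.
  rewrite DE ge0_integral_setU//.
  - by rewrite -DE; exact/measurable_EFinP.
  - by rewrite -DE => u /=; rewrite in_itv/= andbT lee_fin; exact: f0.
  - apply/disj_setPS => u [/=]; rewrite !in_itv/= andbT => /andP[_ us] su.
    by move: us; rewrite leNgt su.
have low u : u \in `[0, s]%classic -> opt_tail (G s) u = 1.
  rewrite inE/= in_itv/= => /andP[u0 us]; rewrite /opt_tail min_l//.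
  by rewrite -[leLHS]sqrtr1 ler_wsqrtr// ler_pdivlMr// mul1r decreasing_noninc.
have high u : u \in `]s, +oo[%classic ->
    opt_tail (G s) u = (Num.sqrt (G s))^-1 * Num.sqrt (G u).
  rewrite inE/= in_itv/= andbT => su; rewrite /opt_tail.
  have u0 : 0 <= u by rewrite (le_trans s0)// ltW.
  rewrite min_r; first by rewrite sqrtrM ?Gge0// sqrtrV ?Gge0// mulrC.
  by rewrite -[leRHS]sqrtr1 ler_wsqrtr// ler_pdivrMr// mul1r decreasing_noninc// ltW.
have mG := measurable_decreasing.
have mo := measurable_opt_tail (G s); have moV := measurable_opt_tailV G0.
have o0 u : 0 <= u -> 0 < opt_tail (G s) u by exact: opt_tail_gt0.
split.
- rewrite split_s//; last by move=> u u0; rewrite ltW// o0.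
  have -> : (\int[mu]_(u in `[0%R, s]) (opt_tail (G s) u)%:E = s%:E)%E.
    under eq_integral => u us do rewrite low//.
    rewrite integral_cst//= lebesgue_measure_itv/= lte_fin mul1e.
    have [_|ss] := ltP 0 s; first by rewrite sube0.
    by rewrite (@le_anti _ _ s 0) ?s0 ?ss.
  have -> : (\int[mu]_(u in `]s, +oo[) (opt_tail (G s) u)%:E =
      \int[mu]_(u in `]s, +oo[) ((Num.sqrt (G s))^-1 * Num.sqrt (G u))%:E)%E.
    by apply: eq_integral => u us; rewrite high.
  by rewrite integral_scaled_sqrtG ?invr_ge0 ?sqrtr_ge0// -hm mulrC.
- rewrite split_s//; last 2 first.
  + exact: measurable_funM.
  + by move=> u u0; rewrite divr_ge0 ?Gge0// ltW// o0.
  have -> : (\int[mu]_(u in `[0%R, s]) (G u / opt_tail (G s) u)%:E =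
      (\int[mu]_(u in `[0%R, s]) G u)%:E)%E.
    rewrite /Rintegral fineK.
      by apply: eq_integral => u us; rewrite low// divr1.
    have iG : mu.-integrable `[0, s] (EFin \o G).
      by apply: integrableS integrable_decreasing => //; apply: subset_itvl.
    exact: integrable_fin_num iG.
  have -> : (\int[mu]_(u in `]s, +oo[) (G u / opt_tail (G s) u)%:E =
      \int[mu]_(u in `]s, +oo[) (Num.sqrt (G s) * Num.sqrt (G u))%:E)%E.
    apply: eq_integral => u us; rewrite high//; move: us; rewrite inE/= in_itv/= andbT => su.
    have u0 : 0 <= u by rewrite (le_trans s0)// ltW.
    have Gu0 : Num.sqrt (G u) != 0 by rewrite gt_eqF// sqrt_decreasing_gt0.
    rewrite -{1}(sqr_sqrtr (Gge0 u0)).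
    by congr (_%:E); field; rewrite Gu0 gt_eqF.
  rewrite integral_scaled_sqrtG ?sqrtr_ge0// -EFinD; congr (_ + _)%:E.
  (* The mean constraint reads [m - s = I s / sqrt (G s)], which turns [sqrt (G s) * I s] into
     [G s * (m - s)]. *)
  rewrite -hm addrAC subrr add0r -{2}(sqr_sqrtr (ltW G0)) expr2.
  by field; rewrite gt_eqF.
Qed.

(** The level is dictated by the mean: the uncapped tail [sqrt (G / lam)] integrates to
    [I 0 / sqrt lam], which equals [m] for [sqrt lam = I 0 / m]. The hypothesis on [m] says that
    this root is at least [sqrt (G 0)], so the cap is never exceeded. *)
Lemma opt_tail_unsaturated (m s : R) : 0 < m -> m <= I 0 / Num.sqrt (G 0) -> 0 <= s ->
  opt_tail ((I 0 / m) ^+ 2) s = m * Num.sqrt (G s) / I 0.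
Proof.
move=> m0 hm s0; have I0 := int_sqrt_gt0 (lexx 0); rewrite /opt_tail.
rewrite sqrtrM ?Gge0// sqrtrV ?sqr_ge0// sqrtr_sqr ger0_norm ?divr_ge0 ?(ltW m0) ?int_sqrt_ge0//.
rewrite min_r; last first.
  rewrite ler_pdivrMr ?divr_gt0// mul1r (le_trans (sqrt_decreasing_noninc (lexx 0) s0))//.
  by move: hm; rewrite !ler_pdivlMr ?sqrt_decreasing_gt0// mulrC.
by field; rewrite !gt_eqF.
Qed.

Lemma opt_tail_integrals_unsaturated (m : R) : 0 < m -> m <= I 0 / Num.sqrt (G 0) ->
  (\int[mu]_(u in D) (opt_tail ((I 0 / m) ^+ 2) u)%:E = m%:E)%E /\
  (\int[mu]_(u in D) (G u / opt_tail ((I 0 / m) ^+ 2) u)%:E = (I 0 ^+ 2 / m)%:E)%E.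
Proof.
move=> m0 hm; have I0 := int_sqrt_gt0 (lexx 0); split.
- transitivity (\int[mu]_(u in D) (m / I 0 * Num.sqrt (G u))%:E)%E.
    apply: eq_integral => u; rewrite inE/= in_itv/= andbT => u0.
    by rewrite opt_tail_unsaturated// mulrAC.
  rewrite integral_scaled_sqrtG ?divr_ge0 ?(ltW m0) ?int_sqrt_ge0//.
  by rewrite divfK// gt_eqF.
- transitivity (\int[mu]_(u in D) (I 0 / m * Num.sqrt (G u))%:E)%E.
    apply: eq_integral => u; rewrite inE/= in_itv/= andbT => u0.
    rewrite opt_tail_unsaturated//.
    have su : Num.sqrt (G u) != 0 by rewrite gt_eqF// sqrt_decreasing_gt0.
    rewrite -{1}(sqr_sqrtr (Gge0 u0)).
    by congr (_%:E); field; rewrite su !gt_eqF.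
  rewrite integral_scaled_sqrtG ?divr_ge0 ?(ltW m0) ?int_sqrt_ge0//.
  by rewrite mulrAC -expr2.
Qed.

End optimal_tail.

(** * Minimisation of the variance *)

Section minimisation.
Context d (Omega : measurableType d) (R : realType) (P : probability Omega R)
  (E : metricType R) (X : R -> Omega -> E) (g : E -> R -> R).
Hypotheses (hg : jointly_measurable X g) (hGconv : Gamma_converges P X g)
  (hGfin : Gamma_weighted_finite P X g)
  (hGge0 : forall s, 0 <= s -> 0 <= Gamma P X g s)
  (hGdecr : forall s t, 0 <= s -> s < t -> Gamma P X g t < Gamma P X g s)
  (hGsmooth : smooth_on `[0, +oo[%classic (Gamma P X g)).
Local Notation mu := (@lebesgue_measure R).
Local Notation D := (`[0, +oo[%classic : set R).
Local Notation G := (Gamma P X g).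

Let Gcont : continuous (fun s : R => G (Num.max s 0)).
Proof. exact: smooth_on_continuous. Qed.

Let mG : measurable_fun D G. Proof. exact: measurable_decreasing. Qed.

Let mGV : measurable_fun D (fun s => (Num.sqrt (G s))^-1).
Proof. exact: measurable_sqrt_decreasingV. Qed.

(** Write [sqrt G] as [G / sqrt G] and bound the numerator by the absolute moment; the result is the
    integrand of [Gamma_weighted_finite]. *)
Lemma sqrt_Gamma_integrable : mu.-integrable D (EFin \o (fun s => Num.sqrt (G s))).
Proof.
have ms : measurable_fun D (fun s => (Num.sqrt (G s))%:E).
  apply/measurable_EFinP; apply: measurableT_comp => //.
  by apply: continuous_measurable_fun; exact: sqrt_continuous.
apply/integrableP; split => //; apply: le_lt_trans hGfin.
apply: ge0_le_integral => //.
- exact: measurableT_comp.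
- apply: emeasurable_funM; first exact/measurable_EFinP.
  exact: measurable_abs_moment.
move=> s /=; rewrite in_itv/= andbT => s0; have sG := sqrt_decreasing_gt0 hGge0 hGdecr s0.
rewrite ger0_norm ?sqrtr_ge0//.
have sE : ((Num.sqrt (G s))%:E = ((Num.sqrt (G s))^-1)%:E * (G s)%:E)%E.
  by rewrite -EFinM -{3}(sqr_sqrtr (hGge0 s0)) expr2 mulKf// gt_eqF.
rewrite [leLHS]sE lee_pmul2l// ?lte_fin ?invr_gt0//.
exact: Gamma_le_abs_moment.
Qed.

(** The inverse of the capped tail is [max 1 (sqrt (lam / G))]. It is at most [c / sqrt G]: the
    first entry requires [c >= sqrt (G 0)], the second [c >= sqrt lam]. The absolute second moment
    is then controlled by [Gamma_weighted_finite]. *)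
Lemma opt_tail_feasible (lam : R) (Q : probability R R) : 0 < lam -> law_class Q ->
  (forall s, 0 <= s -> tail Q s = opt_tail G lam s) -> estimator_abs_L2 P X g Q.
Proof.
move=> lam0 lawQ tailQ; rewrite /estimator_abs_L2 second_moment_abs//.
rewrite lte_mul_pinfty//.
pose c := Num.max (Num.sqrt (G 0)) (Num.sqrt lam).
have c0 : 0 <= c by rewrite le_max sqrtr_ge0.
have mA := measurable_abs_moment P hg.
have A0 s : (0 <= \int[mu]_(t in `[s, +oo[) 'E_P[fun w => `|gX X g s w * gX X g t w|%R])%E.
  by apply: integral_ge0 => t _; exact: expectation_ge0.
apply: (@le_lt_trans _ _ (c%:E * \int[mu]_(s in `[0%R, +oo[)
     (((Num.sqrt (Gamma P X g s))^-1)%:E *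
      \int[mu]_(t in `[s, +oo[) 'E_P[fun w => `|gX X g s w * gX X g t w|%R]))%E); last first.
  by rewrite lte_mul_pinfty.
rewrite -ge0_integralZl//; first last.
- by move=> s _; rewrite mule_ge0// lee_fin invr_ge0 sqrtr_ge0.
- by apply: emeasurable_funM => //; exact/measurable_EFinP.
apply: ge0_le_integral => //.
- by move=> s _; rewrite mule_ge0// lee_fin invr_ge0 tail_ge0.
- apply: emeasurable_funM => //; apply/measurable_EFinP.
  exact: measurable_funTS (measurable_tailV lawQ).
- apply: emeasurable_funM => //; apply: emeasurable_funM => //; exact/measurable_EFinP.
move=> s /=; rewrite in_itv/= andbT => s0; rewrite muleA lee_wpmul2r//.
have sG := sqrt_decreasing_gt0 hGge0 hGdecr s0.
rewrite -EFinM lee_fin tailQ// ler_pdivlMr// mulrC.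
rewrite ler_pdivrMr ?opt_tail_gt0//.
rewrite /opt_tail; have [_|_] := leP 1 (Num.sqrt (G s / lam)).
  by rewrite mulr1 le_max (sqrt_decreasing_noninc hGdecr)// lexx.
rewrite sqrtrM ?hGge0// sqrtrV ?(ltW lam0)// mulrCA ler_pMr//.
by rewrite ler_pdivlMr ?sqrtr_gt0// mul1r le_max lexx orbT.
Qed.

(** Common form of both cases: what remains for each is to choose [lam] and compute two integrals,
    the mean [m] and the cost [v]. *)
Lemma min_variance_opt_tail (lam m v : R) : 0 < lam ->
  (\int[mu]_(u in D) (opt_tail G lam u)%:E = m%:E)%E ->
  (\int[mu]_(u in D) (G u / opt_tail G lam u)%:E = v%:E)%E ->
  (exists2 Q : probability R R,
    (forall s, 0 <= s -> tail Q s = opt_tail G lam s) & attained_at P X g m Q) /\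
  min_variance P X g m = (2 * v - alpha P X g ^+ 2)%:E.
Proof.
move=> lam0 mopt vopt.
have [Q [lawQ tailQ]] := opt_tail_law hGge0 hGdecr Gcont sqrt_Gamma_integrable lam0.
have L2Q := opt_tail_feasible lam0 lawQ tailQ.
have feasQ : feasible P X g m Q.
  split=> //; rewrite expectation_tail// -mopt.
  by apply: eq_integral => s; rewrite inE/= in_itv/= andbT => s0; rewrite tailQ.
have varQ : estimator_variance P X g Q = (2 * v - alpha P X g ^+ 2)%:E.
  rewrite estimator_varianceE// EFinB (EFinM 2 v) -vopt; congr (_ * _ - _)%E.
  by apply: eq_integral => s; rewrite inE/= in_itv/= andbT => s0; rewrite tailQ.
have minE : min_variance P X g m = (2 * v - alpha P X g ^+ 2)%:E.
  apply/eqP; rewrite eq_le; apply/andP; split.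
    by apply: ereal_inf_lbound; exists Q.
  apply: le_ereal_inf_tmp => _ [Q' [lawQ' mQ' L2Q'] <-].
  (* The finite term [alpha ^ 2] and the positive factor 2 cancel in the extended reals, leaving the
     comparison of costs. *)
  rewrite estimator_varianceE// EFinB leeD2rE// (EFinM 2 v) lee_pmul2l// -vopt.
  by apply: (opt_tail_optimal _ _ _ _ _ _ mopt) => //; rewrite -expectation_tail.
by split=> //; exists Q => //; split=> //; rewrite varQ minE.
Qed.

End minimisation.

Theorem theorem2 (R : realType)
  (d : measure_display) (Omega : measurableType d) (P : probability Omega R)
  (E : metricType R) (X : R -> Omega -> E) (g : E -> R -> R)
  (hX : stochastic_process X)
  (hg : jointly_measurable X g)
  (hGconv : Gamma_converges P X g)
  (hGfin : Gamma_weighted_finite P X g)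
  (hGge0 : forall s, 0 <= s -> 0 <= Gamma P X g s)
  (hGdecr : forall s t, 0 <= s -> s < t -> Gamma P X g t < Gamma P X g s)
  (hGsmooth : smooth_on `[0, +oo[%classic (Gamma P X g))
  (m : R) (hm : 0 < m) :
  let G := Gamma P X g in
  let I := int_sqrt_Gamma P X g in
  let a := alpha P X g in
  let V := min_variance P X g m in
  (I 0 / Num.sqrt (G 0) < m ->
     exists2 sstar : R,
       unique (fun s => 0 < s /\ s + I s / Num.sqrt (G s) = m) sstar &
       (exists2 Q : probability R R,
          (forall s, 0 <= s ->
             tail Q s = if s <= sstar then 1 else Num.sqrt (G s / G sstar)) &
          attained_at P X g m Q) /\
       V = (2 * (\int[lebesgue_measure]_(s in `[0, sstar]) G s)
            + 2 * G sstar * (m - sstar) - a ^+ 2)%:E)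
  /\
  (m <= I 0 / Num.sqrt (G 0) ->
     (exists2 Q : probability R R,
        (forall s, 0 <= s -> tail Q s = m * Num.sqrt (G s) / I 0) &
        attained_at P X g m Q) /\
     V = (2 / m * I 0 ^+ 2 - a ^+ 2)%:E).
Proof.
move=> G I a V.
have Gcont := smooth_on_continuous hGsmooth.
have intG := sqrt_Gamma_integrable hg hGconv hGfin hGge0 hGdecr hGsmooth.
have Gpos := decreasing_gt0 hGge0 hGdecr.
have main := min_variance_opt_tail hg hGconv hGfin hGge0 hGdecr hGsmooth.
split=> [hlt|hle].
- have [ss ssU] := saturation_point_exists hGge0 hGdecr Gcont intG hlt.
  have [[ss0 ssm] _] := ssU; have Gss := Gpos _ (ltW ss0).
  have [mopt vopt] := opt_tail_integrals_saturated hGge0 hGdecr Gcont intG (ltW ss0) ssm.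
  have [[Q tailQ attQ] VE] := main _ _ _ Gss mopt vopt.
  exists ss => //; split; last by rewrite /V VE mulrDr mulrA.
  exists Q => // s s0; rewrite tailQ// /opt_tail.
  (* The minimum with 1 is the piecewise formula, since [G s / G ss] is at least 1 up to [ss] and at
     most 1 afterwards. *)
  have [sss|sss] := leP s ss.
    by rewrite min_l// -[leLHS]sqrtr1 ler_wsqrtr// ler_pdivlMr// mul1r (decreasing_noninc hGdecr).
  by rewrite min_r// -[leRHS]sqrtr1 ler_wsqrtr// ler_pdivrMr// mul1r ltW// hGdecr// ltW.
- have I0 : 0 < I 0 by exact: (int_sqrt_gt0 hGge0 hGdecr intG).
  have lam0 : 0 < (I 0 / m) ^+ 2 by rewrite exprn_gt0// divr_gt0.
  have [mopt vopt] := opt_tail_integrals_unsaturated hGge0 hGdecr intG hm hle.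
  have [[Q tailQ attQ] VE] := main _ _ _ lam0 mopt vopt.
  split; last by rewrite /V VE mulrCA mulrC [X in X - _]mulrAC -mulrA.
  exists Q => // s s0.
  by rewrite tailQ// (opt_tail_unsaturated hGge0 hGdecr intG hm hle s0).
Qed.
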